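(* Assume that $L\subseteq\mathbb{N}^{\mathbb{N}}$ is a generalized Luzin set. Then $L$ does not satisfy the $\langle<,\le\rangle$-excluded middle property. In particular, $L$ does not satisfy $\mathsf{U}_{fin}(C_\Gamma,C_{\mathrm{T}})$.
   Context: A set $L\subseteq\mathbb{N}^{\mathbb{N}}$ is a generalized Luzin set if for each meager set $M\subseteq\mathbb{N}^{\mathbb{N}}$, $|L\cap M|<|L|$. For $f,g,h\in\mathbb{N}^{\mathbb{N}}$ and binary relations $R,S$ on $\mathbb{N}$, let $[f\,R\,g]=\{n:f(n)\,R\,g(n)\}$ and $[f\,R\,g\,S\,h]=[f\,R\,g]\cap[g\,S\,h]$. For $Y\subseteq\mathbb{N}^{\mathbb{N}}$, a function $g\in\mathbb{N}^{\mathbb{N}}$ avoids middles in $Y$ with respect to $\langle R,S\rangle$ if: (i) for each $f\in Y$ the set $[f\,R\,g]$ is infinite; (ii) for all $f,h\in Y$ at least one of the sets $[f\,R\,g\,S\,h]$ and $[h\,R\,g\,S\,f]$ is finite. $Y$ satisfies the $\langle R,S\rangle$-excluded middle property if there exists $g\in\mathbb{N}^{\mathbb{N}}$ which avoids middles in $Y$ with respect to $\langle R,S\rangle$. A cover of a space $X$ is a family $\mathcal{U}$ of subsets of $X$ with $X\notin\mathcal{U}$ and $X=\bigcup\mathcal{U}$. A cover $\mathcal{U}$ of $X$ is: a large cover if for each $x\in X$ the set $\{U\in\mathcal{U}:x\in U\}$ is infinite; a $\tau$-cover if it is a large cover and for all $x,y\in X$ at least one of the sets $\{U\in\mathcal{U}:x\in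 U,\ y\notin U\}$, $\{U\in\mathcal{U}:y\in U,\ x\notin U\}$ is finite; a $\gamma$-cover if $\mathcal{U}$ is infinite and for each $x\in X$ the set $\{U\in\mathcal{U}:x\notin U\}$ is finite. $C_{\mathrm{T}}$ and $C_\Gamma$ denote the collections of all countable clopen $\tau$-covers and $\gamma$-covers of $X$, respectively (here $X=L$ with the subspace topology). $X$ satisfies $\mathsf{U}_{fin}(\mathscr{A},\mathscr{B})$ if for each sequence $\langle\mathcal{U}_n:n\in\mathbb{N}\rangle$ of members of $\mathscr{A}$ which do not contain a finite subcover, there exist finite (possibly empty) subsets $\mathcal{F}_n\subseteq\mathcal{U}_n$, $n\in\mathbb{N}$, such that $\{\bigcup\mathcal{F}_n:n\in\mathbb{N}\}\in\mathscr{B}$. *)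

(* Defs.v *)
From HB Require Import structures.
From mathcomp Require Import all_boot all_order.
From mathcomp Require Import all_classical.
From mathcomp Require Export topology function_spaces.

Set Implicit Arguments.
Unset Strict Implicit.
Unset Printing Implicit Defensive.

Local Open Scope classical_set_scope.
Local Open Scope card_scope.

(* The Baire space is [{ptws nat -> nat}]: functions from nat to nat with the
   product topology, each factor nat being discrete. *)

Definition nowhere_dense {X : topologicalType} (A : set X) : Prop :=
  interior (closure A) = set0.

Definition meager {X : topologicalType} (M : set X) : Prop :=
  exists F : nat -> set X,
    (forall n, nowhere_dense (F n)) /\ M = \bigcup_n F n.

Definition card_lt {T U : Type} (A : set T) (B : set U) : Prop :=
  (A #<= B) /\ ~ (B #<= A).

Definition generalized_luzin (L : set {ptws nat -> nat}) : Prop :=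
  forall M : set {ptws nat -> nat}, meager M -> card_lt (L `&` M) L.

Section ExcludedMiddle.
Variables R S : rel nat.

Definition where2 (f g : nat -> nat) : set nat := [set n | R (f n) (g n)].

Definition where3 (f g h : nat -> nat) : set nat :=
  where2 f g `&` [set n | S (g n) (h n)].

Definition avoids_middles (Y : set (nat -> nat)) (g : nat -> nat) : Prop :=
  (forall f, Y f -> infinite_set (where2 f g)) /\
  (forall f h, Y f -> Y h ->
     finite_set (where3 f g h) \/ finite_set (where3 h g f)).

Definition excluded_middle_property (Y : set (nat -> nat)) : Prop :=
  exists g : nat -> nat, avoids_middles Y g.

End ExcludedMiddle.

Section Covers.
Variable X : Type.
Implicit Type U : set (set X).

Definition is_cover U : Prop := ~ U [set: X] /\ \bigcup_(A in U) A = [set: X].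

Definition large_cover U : Prop :=
  is_cover U /\ forall x, infinite_set [set A | U A /\ A x].

Definition tau_cover U : Prop :=
  large_cover U /\
  forall x y, finite_set [set A | U A /\ A x /\ ~ A y] \/
              finite_set [set A | U A /\ A y /\ ~ A x].

Definition gamma_cover U : Prop :=
  [/\ is_cover U, infinite_set U & forall x, finite_set [set A | U A /\ ~ A x]].

Definition has_finite_subcover U : Prop :=
  exists F : set (set X), [/\ finite_set F, F `<=` U & is_cover F].

(* [AA] and [BB] are collections of covers of X. The resulting family of unions
   is taken as a set: repetitions over n are not counted. *)
Definition U_fin (AA BB : set (set (set X))) : Prop :=
  forall U : nat -> set (set X),
    (forall n, AA (U n)) ->
    (forall n, ~ has_finite_subcover (U n)) ->
    exists F : nat -> set (set X),
      (forall n, finite_set (F n) /\ F n `<=` U n) /\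
      BB [set \bigcup_(A in F n) A | n in [set: nat]].

End Covers.

Definition C_T (X : topologicalType) : set (set (set X)) :=
  [set U | [/\ countable U, (forall A, U A -> clopen A) & tau_cover U]].

Definition C_Gamma (X : topologicalType) : set (set (set X)) :=
  [set U | [/\ countable U, (forall A, U A -> clopen A) & gamma_cover U]].

Arguments C_T X : clear implicits.
Arguments C_Gamma X : clear implicits.

(* Main.v *)
Require Import Defs.
From mathcomp Require Import all_boot all_order all_classical.

(** A generalized Luzin set [L] is not meager, since [M := L] would give
    [L `&` M = L], which is not smaller than [L]. Both halves of the theorem
    hold for every nonmeager [L], by covering [L] with two meager sets of the
    kind treated in [meager_almost_always_on]: functions obeying, at almost
    every point of an infinite set, a restriction which excludes some value.

    Excluded middle. Suppose that [g] avoids middles in [L], and write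
    [A_f = [f < g]], an infinite set. As [[f < g <= h] = A_f \ A_h], condition
    (ii) says that the sets [A_f] are linearly ordered by inclusion modulo
    finite sets. For a fixed [f], the functions [h] with [A_f] almost included
    in [A_h] lie below [g] almost everywhere on [A_f] and form a meager set.
    The [h] with [A_h] almost included in [A_f] lie above [g] almost everywhere
    off [A_f]; this is a restriction only where [g > 0], so it defines a meager
    set once [A_f] omits infinitely many points of [P = [0 < g]]. A suitable
    [f] exists in [L], because the [f] with [P] almost included in [A_f] form a
    meager set too.

    Selection principle. The covers of [L] by the sets
    [slab n m = {f in L : f n < m}], [m] varying, are clopen gamma-covers
    without finite subcover for all but finitely many [n]: otherwise [L] would
    be bounded at infinitely many places, hence meager. A finite union of such
    slabs is again a slab, so [U_fin (C_Gamma L) (C_T L)] yields a function [g]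
    for which the sets [slab n (g n)] form a tau-cover, which is almost the
    assertion that [g] avoids middles in [L]. The difference is that a
    tau-cover counts sets while the excluded middle property counts indices; it
    is bridged by [slab_finite_fiber], where nonmeagerness shows that a nonempty
    set equals [slab n (g n)] for only finitely many [n]. *)

Set Implicit Arguments.
Unset Strict Implicit.
Unset Printing Implicit Defensive.

Local Open Scope classical_set_scope.

(** * Meager sets in the Baire space *)

Lemma finite_nat_bounded (K : set nat) :
  finite_set K -> exists b, forall n, K n -> n < b.
Proof.
move=> /finite_seqP[s ->]; exists (\max_(i <- s) i).+1 => n /= ns.
by rewrite ltnS; apply: (@leq_bigmax_seq _ _ _ id).
Qed.

Lemma infinite_nat_unbounded (K : set nat) (b : nat) :
  infinite_set K -> exists2 n, K n & b <= n.
Proof.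
move=> Kinf; apply: contrapT => noK; apply: Kinf.
apply: sub_finite_set (finite_II b) => n Kn /=.
by rewrite ltnNge; apply/negP => bn; apply: noK; exists n.
Qed.

Lemma meager_subset {X : topologicalType} (A B : set X) :
  A `<=` B -> meager B -> meager A.
Proof.
move=> AB [F [Fnd BE]]; exists (fun n => A `&` F n); split=> [n|].
  rewrite /nowhere_dense -subset0 -(Fnd n).
  by apply: interiorS; apply: closureS => x [].
by rewrite -setI_bigcupr -BE; apply/esym/setIidl.
Qed.

Lemma meagerU {X : topologicalType} (A B : set X) :
  meager A -> meager B -> meager (A `|` B).
Proof.
move=> [F [Fnd ->]] [G [Gnd ->]].
exists (fun n => if odd n then F n./2 else G n./2); split=> [n|].
  by case: (odd n).
apply/seteqP; split=> x.
  case=> -[n _ nx]; first by exists n.*2.+1; rewrite //= odd_double uphalf_double.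
  by exists n.*2; rewrite //= odd_double doubleK.
by case=> n _; case: (odd n) => nx; [left|right]; exists n./2.
Qed.

Lemma generalized_luzin_nonmeager (L : set {ptws nat -> nat}) :
  generalized_luzin L -> ~ meager L.
Proof. by move=> hL /hL; rewrite setIid => -[]. Qed.

Definition almost_always_on (K : set nat) (Q : nat -> nat -> Prop) :
  set {ptws nat -> nat} :=
  [set f | finite_set [set n | K n /\ ~ Q n (f n)]].

(** Changing [f] at a single far point [n] of [K] to a value forbidden by [Q n]
    gives functions that converge to [f], while each of them has a
    neighbourhood, fixing the value at [n], that misses the set. So [f] is not
    interior to the closure. *)
Lemma nowhere_dense_always_on (K : set nat) (Q : nat -> nat -> Prop) :
  infinite_set K -> (forall n, K n -> exists v, ~ Q n v) ->
  nowhere_dense ([set f | forall n, K n -> Q n (f n)] : set {ptws nat -> nat}).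
Proof.
move=> Kinf Kbad; rewrite /nowhere_dense -subset0 => f.
set N := [set f | _] => fN.
have /choice[p pP] : forall j, exists p : nat * nat,
    [/\ K p.1, j <= p.1 & ~ Q p.1 p.2].
  move=> j; have [n Kn jn] := infinite_nat_unbounded j Kinf.
  by have [v Qv] := Kbad n Kn; exists (n, v).
pose h j : {ptws nat -> nat} := dfwith f (p j).1 (p j).2.
have hf : h @ \oo --> f.
  apply/pointwise_cvgP => t; apply/discrete_cvg.
  exists t.+1 => // j /= tj; rewrite /h dfwithout //.
  by have [_ jp _] := pP j; rewrite neq_ltn (leq_trans tj jp) orbT.
have [j _ /(_ j (leqnn j)) /= hN] := hf _ fN.
have [Kp _ Qp] := pP j.
have hp : h j (p j).1 = (p j).2 by rewrite /h dfwithin.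
have : nbhs (h j) (proj (p j).1 @^-1` [set (p j).2]).
  by apply: proj_continuous; rewrite /proj hp; exact: discrete_set1.
by move=> /hN[e [eN /= ep]]; apply: Qp; rewrite -ep; exact: eN.
Qed.

(** The set is the union over [m] of the sets of functions that obey [Q] at
    every point of [K] from [m] on, to which the previous lemma applies. *)
Lemma meager_almost_always_on (K : set nat) (Q : nat -> nat -> Prop) :
  infinite_set K -> (forall n, K n -> exists v, ~ Q n v) ->
  meager (almost_always_on K Q).
Proof.
move=> Kinf Kbad.
exists (fun m => [set f | forall n, (K `&` [set n | m <= n]) n -> Q n (f n)]).
split=> [m|].
  apply: nowhere_dense_always_on => [|n [/Kbad]//].
  move=> fin; apply: Kinf.
  apply: sub_finite_set (_ : finite_set ((K `&` [set n | m <= n]) `|` `I_m)).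
    by move=> n Kn; have [mn|nm] := leqP m n; [left|right].
  by rewrite finite_setU; split; [exact: fin|exact: finite_II].
apply/seteqP; split=> f.
  move=> /finite_nat_bounded[b bP]; exists b => // n [Kn /= bn].
  apply: contrapT => Qn; have /bP : K n /\ ~ Q n (f n) by [].
  by rewrite ltnNge bn.
move=> [m _ mP]; apply: sub_finite_set (finite_II m) => n [Kn Qn] /=.
by rewrite ltnNge; apply/negP => mn; apply: Qn; exact: mP.
Qed.

(** * The excluded middle property *)

(** If [g] avoids middles in [L], then for [f] in [L] every other [h] in [L] is
    below [g] almost everywhere on [[f < g]], or above [g] almost everywhere off
    it. Taking [f] with [[f < g]] not almost all of [[0 < g]] makes both
    alternatives meager. *)
Lemma no_excluded_middle (L : set {ptws nat -> nat}) :
  ~ meager L -> ~ excluded_middle_property ltn leq L.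
Proof.
move=> Lnm [g [ginf gmid]].
have [f0 Lf0] : exists f, L f.
  apply: contrapT => noL; apply: Lnm; exists (fun=> set0); split=> [n|].
    by rewrite /nowhere_dense closure0 interior0.
  by rewrite bigcup0//; apply/seteqP; split=> // f Lf; apply: noL; exists f.
pose P := [set n | 0 < g n].
have Pinf : infinite_set P.
  move=> Pfin; apply: (ginf f0 Lf0); apply: sub_finite_set Pfin => n.
  exact: leq_ltn_trans.
pose M0 := almost_always_on P (fun n v => v < g n).
(* Only an [f] outside [M0] leaves infinitely many points of [P] off [f < g]. *)
have M0m : meager M0.
  by apply: meager_almost_always_on => // n _; exists (g n); rewrite ltnn.
have [f Lf M0f] : exists2 f, L f & ~ M0 f.
  apply: contrapT => noL; apply: Lnm; apply: meager_subset M0m => f Lf.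
  by apply: contrapT => M0f; apply: noL; exists f.
apply: Lnm; pose A := where2 ltn f g.
pose B := [set n | P n /\ ~ f n < g n].
apply: (@meager_subset _ _ (almost_always_on A (fun n v => v < g n) `|`
    almost_always_on B (fun n v => g n <= v))).
  move=> h Lh; have [fin|fin] := gmid f h Lf Lh; [left|right].
    by apply: sub_finite_set fin => n [An /negP]; rewrite -leqNgt; split.
  apply: sub_finite_set fin => n [[_ fg] /negP hg].
  by split; rewrite /= /where2 /= ?ltnNge// leqNgt; exact/negP.
apply: meagerU; apply: meager_almost_always_on => //.
- exact: ginf.
- by move=> n _; exists (g n); rewrite ltnn.
- by move=> n [+ _]; exists 0; apply/negP; rewrite -ltnNge.
Qed.

(** * Covers by slabs *)

Section Slabs.
Variable L : set {ptws nat -> nat}.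

Definition slab (n m : nat) : set (set_type L) :=
  [set x | (set_val x : nat -> nat) n < m].

Lemma clopen_slab n m : clopen (slab n m).
Proof.
have c : continuous (proj n \o (set_val : set_type L -> {ptws nat -> nat})).
  move=> x; apply: (@continuous_comp _ {ptws nat -> nat} _ set_val (proj n)).
    exact: (@initial_continuous (set_type L) {ptws nat -> nat} set_val).
  exact: proj_continuous.
apply: (@preimage_clopen _ _ _ [set v | v < m]) c.
by split; [exact: discrete_open|exact: discrete_closed].
Qed.

(** This is what turns the finite selections provided by [U_fin] into a single
    function [g]; the empty selection corresponds to [g n = 0]. *)
Lemma bigcup_slab n (F : set (set (set_type L))) :
  finite_set F -> F `<=` range (slab n) ->
  exists m, \bigcup_(A in F) A = slab n m.
Proof.
move=> /finite_seqP[s ->] sub; rewrite bigcup_seq big_seq.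
apply: (big_ind (fun A => exists m, A = slab n m)).
- by exists 0; apply/seteqP; split.
- move=> _ _ [a ->] [b ->]; exists (maxn a b); apply/seteqP; split=> x;
    rewrite /slab /= leq_max; by move/orP.
- by move=> A /sub[m _ <-]; exists m.
Qed.

Lemma slab_no_finite_subcover n : (forall m, slab n m <> setT) ->
  ~ has_finite_subcover (range (slab n)).
Proof.
move=> nT [F [Ffin Fsub [_ FT]]].
by have [m mE] := bigcup_slab Ffin Fsub; apply: (nT m); rewrite -mE.
Qed.

Lemma C_Gamma_slab n : (forall m, slab n m <> setT) ->
  C_Gamma (set_type L) (range (slab n)).
Proof.
move=> nT.
have cov : is_cover (range (slab n)).
  split; first by move=> [m _ /nT].
  apply/seteqP; split=> // x _.
  pose m := ((set_val x : nat -> nat) n).+1.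
  by exists (slab n m); [exists m|exact: ltnSn].
split.
- exact: card_image_le.
- by move=> _ [m _ <-]; exact: clopen_slab.
- split=> // [fin|x].
    by apply: (slab_no_finite_subcover nT); exists (range (slab n)); split.
  have fin := finite_II ((set_val x : nat -> nat) n).+1.
  apply: sub_finite_set (finite_image (slab n) fin).
  by move=> _ [[m _ <-] nx]; exists m => //=; rewrite ltnS leqNgt; exact/negP.
Qed.

(** If all values [f n] with [f] in [L] were bounded by [b n] for infinitely many
    [n], then [L] would be meager. *)
Lemma slab_unbounded :
  ~ meager L -> exists N, forall n m, N <= n -> slab n m <> setT.
Proof.
move=> Lnm; pose K := [set n | exists m, slab n m = setT].
have /finite_nat_bounded[N NP] : finite_set K.
  apply: contrapT => Kinf; apply: Lnm.
  have /choice[b bP] : forall n, exists b, K n -> slab n b = setT.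
    move=> n; have [[b bT]|nK] := pselect (K n); first by exists b.
    by exists 0.
  apply: (@meager_subset _ _ (almost_always_on K (fun n v => v < b n))).
    move=> f Lf; apply: sub_finite_set (_ : finite_set set0) => // n [/bP bT].
    by apply; have : slab n (b n) (exist _ f (mem_set Lf)) by rewrite bT.
  by apply: meager_almost_always_on => // n _; exists (b n); rewrite ltnn.
by exists N => n m Nn nT; have /NP : K n by [exists m]; rewrite ltnNge Nn.
Qed.

(** Were [slab n (g n) = A] for all [n] in an infinite set [J], every [f] in [A]
    would lie below [g] on all of [J], and every [f] in [L] off [A] would lie
    above [g] there. Both conditions are meager; for the second this needs
    [g > 0] on [J], which holds because [A] is nonempty. *)
Lemma slab_finite_fiber (g : nat -> nat) (A : set (set_type L)) :
  ~ meager L -> A !=set0 -> finite_set [set n | slab n (g n) = A].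
Proof.
move=> Lnm [x Ax]; apply: contrapT; set J := [set n | _] => Jinf; apply: Lnm.
have Jg n : J n -> 0 < g n.
  by move=> Jn; move: Ax; rewrite -Jn; exact: leq_ltn_trans.
apply: (@meager_subset _ _ (almost_always_on J (fun n v => v < g n) `|`
    almost_always_on J (fun n v => g n <= v))).
  move=> f Lf; pose y : set_type L := exist _ f (mem_set Lf).
  have [Ay|nAy] := pselect (A y); [left|right];
      apply: sub_finite_set (_ : finite_set set0) => // n [Jn]; apply.
    by have : slab n (g n) y by rewrite Jn.
  by rewrite leqNgt; apply/negP => fg; apply: nAy; rewrite -Jn.
apply: meagerU; apply: meager_almost_always_on => // n.
- by exists (g n); rewrite ltnn.
- by move=> /Jg; exists 0; apply/negP; rewrite -ltnNge.
Qed.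

(** The function [g] is read off from the finite selections among the covers at
    the places [n >= N], and is set to [0] below [N] so that these finitely many
    places never satisfy [f n < g n]. Condition (i) is largeness of the selected
    cover. Condition (ii) is the tau-property, pulled back along the
    finite-to-one map [n |-> slab n (g n)]. *)
Lemma U_fin_excluded_middle :
  ~ meager L ->
  U_fin (C_Gamma (set_type L)) (C_T (set_type L)) ->
  excluded_middle_property ltn leq L.
Proof.
move=> Lnm; have [N NP] := slab_unbounded Lnm.
have NkP k m : slab (N + k) m <> setT by apply: NP; exact: leq_addr.
move=> /(_ (fun k => range (slab (N + k)))) [].
- by move=> k; apply: C_Gamma_slab.
- by move=> k; apply: slab_no_finite_subcover.
move=> F [Fsub [_ _ [[_ Vlarge] Vtau]]].
have /choice[g0 g0P] : forall k, exists m, \bigcup_(A in F k) A = slab (N + k) m.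
  by move=> k; have [] := Fsub k; exact: bigcup_slab.
pose g n := if n < N then 0 else g0 (n - N).
have gk k : g (N + k) = g0 k by rewrite /g ltnNge leq_addr addKn.
pose S n := slab n (g n).
have VE k : \bigcup_(A in F k) A = S (N + k) by rewrite g0P /S gk.
exists g; split=> [f Lf fin|f h Lf Lh].
  pose x : set_type L := exist _ f (mem_set Lf).
  apply: (Vlarge x); apply: sub_finite_set (finite_image S fin).
  by move=> _ [[k _ <-]]; rewrite VE => Sx; exists (N + k).
have key (f1 f2 : {ptws nat -> nat}) (L1 : L f1) (L2 : L f2) :
    let x : set_type L := exist _ f1 (mem_set L1) in
    let y : set_type L := exist _ f2 (mem_set L2) in
    finite_set [set A | [set \bigcup_(A in F n) A | n in [set: nat]] A /\
                        A x /\ ~ A y] ->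
    finite_set (where3 ltn leq f1 g f2).
  move=> x y Vfin.
  apply: sub_finite_set (bigcup_finite Vfin (_ : forall A, _ ->
    finite_set [set n | S n = A])).
    move=> n [/= n1 n2]; exists (S n) => //; split.
      exists (n - N) => //; rewrite VE subnKC// leqNgt; apply/negP => nN.
      by move: n1; rewrite /where2 /= /g nN.
    by split => //; apply/negP; rewrite -leqNgt.
  by move=> A [_ [Ax _]]; apply: slab_finite_fiber => //; exists x.
have [/key ?|/key ?] := Vtau (exist _ f (mem_set Lf)) (exist _ h (mem_set Lh)).
  by left.
by right.
Qed.

End Slabs.

Theorem theorem3p1 (L : set {ptws nat -> nat}) (hL : generalized_luzin L) :
  ~ excluded_middle_property ltn leq L /\
  ~ U_fin (C_Gamma (set_type L)) (C_T (set_type L)).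
Proof.
have Lnm := generalized_luzin_nonmeager hL.
have noEM := no_excluded_middle Lnm.
by split=> // /(U_fin_excluded_middle Lnm).
Qed.
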